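(* Let $\mathcal{H}$ be either an affine plane or a projective plane of order $q$, regarded as a hypergraph whose vertices are the points and whose edges are the lines. Then $\chi^{e}(\mathcal{H})=2$.
   Context: A projective plane of order $q$ is a pair $(X,\mathcal{L})$ with $|X|=q^2+q+1$ points and a family $\mathcal{L}$ of $q^2+q+1$ subsets of $X$ (lines), each of size $q+1$, such that every point lies on $q+1$ lines, any two points lie on a unique line, and any two lines meet in exactly one point. An affine plane of order $q$ is a pair $(X,\mathcal{L})$ with $|X|=q^2$ points and $q^2+q$ lines, each line having $q$ points, any two points lying on a unique line, and each point lying on $q+1$ lines. For $w:E\to\{1,\dots,k\}$, $\sigma^{e}(v)=\sum_{e\ni v}w(e)$; a vertex coloring is proper if every edge contains two vertices of distinct colors; $\chi^{e}(\mathcal{H})$ is the least $k$ such that some $w$ makes $\sigma^{e}$ proper.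
   Formalization: The order is required to be q ≥ 3 for affine planes and q ≥ 2 for projective planes; the claim fails for smaller q (the affine plane of order 2 is K_4 and the projective plane of order 1 is K_3, both not edge-sum colorable with weights 1, 2). *)

(* Defs.v *)
From mathcomp Require Import all_boot.

Set Implicit Arguments.
Unset Strict Implicit.
Unset Printing Implicit Defensive.

Section Hypergraphs.

Variables (V : finType) (E : {set {set V}}).

(* Only the values of [w] on the members of [E] matter. *)
Definition edge_weighting (k : nat) (w : {set V} -> nat) : Prop :=
  forall e, e \in E -> 1 <= w e <= k.

Definition edge_sum (w : {set V} -> nat) (v : V) : nat :=
  \sum_(e in E | v \in e) w e.

Definition proper_coloring (C : Type) (c : V -> C) : Prop :=
  forall e, e \in E -> exists x y : V, [/\ x \in e, y \in e & c x <> c y].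

Definition edge_sum_colorable (k : nat) : Prop :=
  exists w, edge_weighting k w /\ proper_coloring (edge_sum w).

(* [chi^e(V, E) = k]. This is a relation because no [k] works for some
   hypergraphs, e.g. those with an edge of size one. *)
Definition chi_e_is (k : nat) : Prop :=
  edge_sum_colorable k /\ forall j, edge_sum_colorable j -> k <= j.

End Hypergraphs.

Record projective_plane (q : nat) (X : finType) (L : {set {set X}}) : Prop :=
  ProjectivePlane {
    projective_points : #|X| = q ^ 2 + q + 1;
    projective_lines : #|L| = q ^ 2 + q + 1;
    projective_line_size : forall l, l \in L -> #|l| = q + 1;
    projective_point_degree : forall x : X, #|[set l in L | x \in l]| = q + 1;
    projective_join : forall x y : X, x != y ->
      exists! l : {set X}, [/\ l \in L, x \in l & y \in l];
    projective_meet : forall l m, l \in L -> m \in L -> l != m ->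
      #|l :&: m| = 1
  }.

Record affine_plane (q : nat) (X : finType) (L : {set {set X}}) : Prop :=
  AffinePlane {
    affine_points : #|X| = q ^ 2;
    affine_lines : #|L| = q ^ 2 + q;
    affine_line_size : forall l, l \in L -> #|l| = q;
    affine_join : forall x y : X, x != y ->
      exists! l : {set X}, [/\ l \in L, x \in l & y \in l];
    affine_point_degree : forall x : X, #|[set l in L | x \in l]| = q + 1
  }.

(* Main.v *)
(** Give weight 2 to two lines [l], [m] meeting in a point [p], and weight 1 to
    all others: the colour of [x] is then [q + 1] plus the number of lines among
    [l], [m] through [x]. On [l] and [m] the point [p] differs from every other
    point. Any other line has a point off [l] and [m], since it meets each of
    them at most once and has at least three points; and it meets [l] or [m],
    since among the [q + 1] lines through [p] at most one misses it. *)
Require Import Defs.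
From mathcomp Require Import all_boot.

Set Implicit Arguments.
Unset Strict Implicit.
Unset Printing Implicit Defensive.

Section RegularHypergraph.

Variables (V : finType) (E : {set {set V}}) (d : nat).
Hypothesis regE : forall v, #|[set e in E | v \in e]| = d.

(** If [j <= 1], all weights on [E] equal 1, so each sum is the degree [d] and no edge sees two
    colours. *)
Lemma edge_sum_colorable_ge2 j : E != set0 -> edge_sum_colorable E j -> 1 < j.
Proof.
case/set0Pn=> e eE [w [w_le /(_ e eE) [x [y [_ _ neq_xy]]]]].
rewrite ltnNge; apply/negP=> j_le1; apply: neq_xy.
suff sum_d v : edge_sum E w v = d by rewrite !sum_d.
rewrite -(regE v) cardsE -sum1_card; apply: eq_bigr => f /andP[fE _].
by apply/eqP; rewrite eqn_leq; case/andP: (w_le f fE) => -> /leq_trans->.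
Qed.

Lemma sum_indicator l v : l \in E ->
  \sum_(e in E | v \in e) (e == l) = (v \in l).
Proof.
move=> lE; rewrite big_mkcond (bigD1 l) //= lE eqxx big1 ?addn0 /=.
  by case: (v \in l).
by move=> e /negPf->; rewrite if_same.
Qed.

Lemma edge_sum_two_heavy l m v : l \in E -> m \in E ->
  edge_sum E (fun e => 1 + ((e == l) + (e == m))) v
    = d + ((v \in l) + (v \in m)).
Proof.
move=> lE mE; rewrite /edge_sum !big_split /= !sum_indicator //.
by rewrite sum1_card -(regE v) cardsE.
Qed.

End RegularHypergraph.

Section LinearSpace.

Variables (V : finType) (E : {set {set V}}) (d : nat).
Hypothesis regE : forall v, #|[set e in E | v \in e]| = d.
Hypothesis joinE : forall x y : V, x != y ->
  exists! l : {set V}, [/\ l \in E, x \in l & y \in l].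

Lemma line_unique l m x y : l \in E -> m \in E -> x != y ->
  x \in l -> y \in l -> x \in m -> y \in m -> l = m.
Proof.
move=> lE mE /joinE[k [_ uniq_k]] xl yl xm ym.
by rewrite -(uniq_k l) // -(uniq_k m).
Qed.

Lemma card_line_meet l m : l \in E -> m \in E -> l != m -> #|l :&: m| <= 1.
Proof.
move=> lE mE neq_lm; apply/card_le1_eqP=> x y /setIP[xl xm] /setIP[yl ym].
have [//|neq_xy] := eqVneq x y.
by case/eqP: neq_lm; apply: (line_unique lE mE neq_xy).
Qed.

(** If [n] missed both [l] and [m], joining [p] to the points of [n] would give [#|n|] lines, which
    together with [l] and [m] make [#|n| + 2 > d] lines through [p]. *)
Lemma line_meets_one_of_two l m n p : l \in E -> m \in E -> n \in E ->
  l != m -> p \in l -> p \in m -> d <= #|n|.+1 ->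
  exists2 x, x \in n & (x \in l) || (x \in m).
Proof.
move=> lE mE nE neq_lm pl pm d_le.
have [/existsP[x /andP[]]|] := boolP [exists x, (x \in n) && ((x \in l) || (x \in m))].
  by exists x.
rewrite negb_exists => /forallP miss.
have missl x : x \in n -> x \notin l.
  by move=> xn; have:= miss x; rewrite xn negb_or => /andP[].
have missm x : x \in n -> x \notin m.
  by move=> xn; have:= miss x; rewrite xn negb_or => /andP[].
have pn : p \notin n by apply: contraL pl => /missl.
(* [g y] is the line joining [p] to [y]; for [y] on [n] the default [set0] never occurs, since [p]
   is off [n]. *)
pose g y := odflt set0 [pick k in E | (p \in k) && (y \in k)].
have gP y : y \in n -> [/\ g y \in E, p \in g y & y \in g y].
  move=> yn; rewrite /g; case: pickP => [k /and3P[] //|none].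
  have /joinE[k [[kE pk yk] _]] : p != y by apply: contraNneq pn => ->.
  by have:= none k; rewrite kE pk yk.
have g_inj : {in n &, injective g}.
  (* A line through [p] with two points of [n] would be [n] itself, which misses [p]. *)
  move=> x y xn yn eq_g; have [//|neq_xy] := eqVneq x y.
  have [gE pg xg] := gP x xn; have [_ _ yg] := gP y yn.
  by case/negP: pn; rewrite -(line_unique gE nE neq_xy) // eq_g.
have sub : l |: (m |: g @: n) \subset [set e in E | p \in e].
  apply/subsetP=> e /setU1P[->|/setU1P[->|/imsetP[y /gP[gE pg _] ->]]];
  by rewrite inE ?lE ?mE ?gE.
have := subset_leq_card sub; rewrite regE !cardsU1 (card_in_imset g_inj).
have -> : m \notin g @: n.
  by apply/imsetP=> -[y yn em]; have [_ _] := gP y yn; rewrite -em (negPf (missm y yn)).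
have -> : l \notin m |: g @: n.
  rewrite in_setU1 negb_or neq_lm; apply/imsetP=> -[y yn el].
  by have [_ _] := gP y yn; rewrite -el (negPf (missl y yn)).
by move/leq_trans=> /(_ _ d_le); rewrite !add1n ltnn.
Qed.

Hypothesis size_ge3 : forall l, l \in E -> 2 < #|l|.

Lemma line_avoids_two l m n : l \in E -> m \in E -> n \in E ->
  n != l -> n != m -> exists x, [/\ x \in n, x \notin l & x \notin m].
Proof.
move=> lE mE nE neq_nl neq_nm.
have /subsetPn[x xn] : ~~ (n \subset l :|: m).
  apply/negP=> /setIidPl; rewrite setIUr => eq_n.
  have := size_ge3 nE; rewrite -eq_n ltnNge (leq_trans (leq_card_setU _ _)) //.
  by rewrite -[2]/(1 + 1) leq_add // card_line_meet.
by rewrite in_setU negb_or => /andP[]; exists x.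
Qed.

Lemma line_not_subset l m p : l \in E -> m \in E -> l != m ->
  p \in l -> p \in m -> exists2 x, x \in l & x \notin m.
Proof.
move=> lE mE neq_lm pl pm; apply/subsetPn/negP=> /setIidPl eq_l.
by have := card_line_meet lE mE neq_lm; rewrite eq_l leqNgt ltnW // size_ge3.
Qed.

(** The bound [d <= #|l|.+1] is common to both kinds of plane and stands in for their different
    rules on when lines meet. *)
Lemma linear_space_chi_e (p : V) : 1 < d ->
  (forall l, l \in E -> d <= #|l|.+1) -> chi_e_is E 2.
Proof.
move=> d_gt1 d_le.
have /card_gt1P[l [m [/setIdP[lE pl] /setIdP[mE pm] neq_lm]]] :
  1 < #|[set e in E | p \in e]| by rewrite regE.
split=> [|j]; last by apply: (edge_sum_colorable_ge2 regE); apply/set0Pn; exists l.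
exists (fun e => 1 + ((e == l) + (e == m))); split=> [e _ | n nE].
  (* Weight 3 would need [e] to be both [l] and [m]. *)
  by have [->|_] := eqVneq e l; rewrite ?(negPf neq_lm) //; case: (e == m).
suff [x [y [xn yn neq_xy]]] : exists x y, [/\ x \in n, y \in n &
    (x \in l) + (x \in m) != (y \in l) + (y \in m)].
  exists x, y; split=> //; rewrite !(edge_sum_two_heavy regE) //.
  by apply/eqP; rewrite eqn_add2l.
have [->|neq_nl] := eqVneq n l.
  (* The indicators add up to 2 at [p] and to 1 at [x]. *)
  have [x xl xm] := line_not_subset lE mE neq_lm pl pm.
  by exists p, x; rewrite pl pm xl (negPf xm).
have [->|neq_nm] := eqVneq n m.
  have neq_ml : m != l by rewrite eq_sym.
  have [x xm xl] := line_not_subset mE lE neq_ml pm pl.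
  by exists p, x; rewrite pl pm xm (negPf xl).
have [x [xn xl xm]] := line_avoids_two lE mE nE neq_nl neq_nm.
have [y yn ylm] := line_meets_one_of_two lE mE nE neq_lm pl pm (d_le n nE).
(* The indicator sum is 0 at [x] and positive at [y]. *)
exists x, y; rewrite (negPf xl) (negPf xm); split=> //.
by case/orP: ylm => ->; rewrite ?addn1.
Qed.

End LinearSpace.

(* Lines have at least three points: for lines of two points (the affine plane
   of order 2 is K_4, the projective "plane" of order 1 is K_3) chi^e is 3. *)
Theorem theorem3p7 (q : nat) (X : finType) (L : {set {set X}}) :
  (affine_plane q L /\ 2 < q) \/ (projective_plane q L /\ 1 < q) ->
  chi_e_is L 2.
Proof.
case=> [[[cardX _ size_l join deg] q_gt]|[[cardX _ size_l deg join _] q_gt]].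
  (* Affine case: [d = q + 1] and [#|l| = q], so the bound on [d] is an equality. *)
  have /card_gt0P[p _] : 0 < #|X| by rewrite cardX expn_gt0 (ltn_trans _ q_gt).
  apply: (linear_space_chi_e deg join _ p) => [l /size_l->||l /size_l->] //.
    by rewrite addn1 ltnS (ltn_trans _ q_gt).
  by rewrite addn1.
(* Projective case: [#|l| = q + 1 = d], so [1 < q] already gives three points on a line. *)
have /card_gt0P[p _] : 0 < #|X| by rewrite cardX addn1.
apply: (linear_space_chi_e deg join _ p) => [l /size_l->||l /size_l->] //.
- by rewrite addn1.
- by rewrite addn1 ltnS ltnW.
Qed.
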